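(* For every integer $m\geqslant 1$ there is a polynomial $p_m$ in two real variables such that the following holds for every $d\geqslant 2$, every real symmetric positive definite $d\times d$ matrix $B$ with eigenvalues $\lambda_1\geqslant\dots\geqslant\lambda_d>0$ (counted with multiplicity), and all vectors $v^{(1)},\dots,v^{(m)}\in\mathbb{R}^d$. Put $$A^{(m)} = B + \sqrt{B}\sum_{k=1}^m v^{(k)} [v^{(k)}]^T \sqrt{B},\qquad C_m = p_m\Big(d,\max_{k=1,\dots,m}\|v^{(k)}\|\Big).$$ Then $C_m>0$, and for all $i,j\in\{1,\dots,d\}$, if $e_i^{(m)}$ is a unit eigenvector corresponding to the $i$-th largest eigenvalue (counted with multiplicity) of $A^{(m)}$ and $e_j^{(0)}$ is a unit eigenvector corresponding to the $j$-th largest eigenvalue $\lambda_j$ of $B$, then $$\left|\left\langle e_i^{(m)}, e_j^{(0)} \right\rangle\right| \leqslant C_m\sqrt{\frac{\min\{\lambda_i,\lambda_j\}}{\max\{\lambda_i,\lambda_j\}}}.$$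
   Context: $\sqrt{B}$ denotes the unique symmetric positive definite matrix with $\sqrt{B}\sqrt{B}=B$; if $B=P\,\mathrm{diag}(\lambda_1,\dots,\lambda_d)P^T$ with $P$ orthogonal, then $\sqrt{B}=P\,\mathrm{diag}(\sqrt{\lambda_1},\dots,\sqrt{\lambda_d})P^T$. $\langle\cdot,\cdot\rangle$ and $\|\cdot\|$ are the standard Euclidean inner product and norm on $\mathbb{R}^d$. Unit eigenvectors are eigenvectors of Euclidean norm $1$. *)

(* Defs.v *)
(* MathComp / MathComp-Analysis development: the real numbers are an arbitrary
   [R : realType], vectors of R^d are columns ['cV[R]_d]. *)
From mathcomp Require Import all_boot all_order all_algebra.
From mathcomp Require Import boolp classical_sets reals.

Set Implicit Arguments.
Unset Strict Implicit.
Unset Printing Implicit Defensive.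

Import Order.TTheory GRing.Theory Num.Theory.

Local Open Scope classical_set_scope.
Local Open Scope ring_scope.

Section Defs.
Context {R : realType}.

Definition inner {d : nat} (x y : 'cV[R]_d) : R := (x^T *m y) 0 0.

(* The norm [`|x|] that MathComp-Analysis puts on matrices is the sup norm,
   hence a separate definition of the Euclidean norm. *)
Definition enorm {d : nat} (x : 'cV[R]_d) : R := Num.sqrt (inner x x).

Definition sym_posdef {d : nat} (B : 'M[R]_d) : Prop :=
  B^T = B /\ forall x : 'cV[R]_d, x != 0 -> 0 < inner x (B *m x).

(* When [B] is symmetric positive definite the set below is a singleton by the
   spectral theorem, so the choice operator returns its unique element; the
   default value 0 is relevant only when the set is empty. *)
Definition sqrtmx {d : nat} (B : 'M[R]_d) : 'M[R]_d :=
  xget 0 [set S : 'M[R]_d | sym_posdef S /\ S *m S = B].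

(* [lam] lists all the eigenvalues of [A], repeated according to their
   (algebraic) multiplicity, in nonincreasing order; indices start at 0, so
   that [lam i] is the (i+1)-st largest eigenvalue. *)
Definition ordered_eigenvalues {d : nat} (A : 'M[R]_d) (lam : 'I_d -> R) : Prop :=
  (forall i j : 'I_d, (i <= j)%N -> lam j <= lam i) /\
  char_poly A = \prod_(i < d) ('X - (lam i)%:P).

Definition unit_eigenvector {d : nat} (A : 'M[R]_d) (a : R) (e : 'cV[R]_d) : Prop :=
  A *m e = a *: e /\ enorm e = 1.

Definition perturbed {d m : nat} (B : 'M[R]_d) (v : 'I_m -> 'cV[R]_d) : 'M[R]_d :=
  B + sqrtmx B *m (\sum_(k < m) v k *m (v k)^T) *m sqrtmx B.

(* Since norms are nonnegative, the neutral element 0 of the iterated maximum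
   does not affect its value when [0 < m]. *)
Definition max_enorm {d m : nat} (v : 'I_m -> 'cV[R]_d) : R :=
  \big[Num.max/0]_(k < m) enorm (v k).

End Defs.

(* Main.v *)
(* Write S = sqrt B, M = 1 + sum_k v_k v_k^T and c = 1 + m max_k |v_k|^2, so
   that A = S M S and 1 <= M <= c as quadratic forms. Hence B <= A <= c B, and by
   Weyl's monotonicity lam_i <= mu_i <= c lam_i. Let t = <e, f> with A e = mu_i e
   and B f = lam_j f, hence S f = sqrt(lam_j) f. Then
     lam_j t^2 = <S e, f>^2 <= |S e|^2 <= <S e, M S e> = mu_i <= c lam_i,
   and mu_i t = <S M S e, f> = sqrt(lam_j) <S e, M f>, so Cauchy-Schwarz for the
   form M gives mu_i^2 t^2 <= lam_j mu_i <f, M f> <= c lam_j mu_i, that is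
     lam_i t^2 <= mu_i t^2 <= c lam_j.
   Since sqrt c <= c, the polynomial p_m(d, y) = 1 + m y^2 works; it does not
   depend on d. *)
Require Import Defs.
From mathcomp Require Import all_boot all_order all_algebra.
From mathcomp Require Import boolp classical_sets reals.
From mathcomp Require Import ring.

Set Implicit Arguments.
Unset Strict Implicit.
Unset Printing Implicit Defensive.

Import Order.TTheory GRing.Theory Num.Theory.

Local Open Scope ring_scope.

(** * Euclidean inner product and the Cauchy-Schwarz inequality for positive definite forms *)

Section Inner.
Context {R : realType}.
Implicit Types d : nat.

Lemma innerE d (x y : 'cV[R]_d) : inner x y = \sum_k x k 0 * y k 0.
Proof. by rewrite /inner mxE; apply: eq_bigr => k _; rewrite mxE. Qed.

Lemma innerC d (x y : 'cV[R]_d) : inner x y = inner y x.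
Proof. by rewrite !innerE; apply: eq_bigr => k _; rewrite mulrC. Qed.

Lemma innerDr d (x y z : 'cV[R]_d) : inner x (y + z) = inner x y + inner x z.
Proof. by rewrite /inner mulmxDr mxE. Qed.

Lemma innerZr d (a : R) (x y : 'cV[R]_d) : inner x (a *: y) = a * inner x y.
Proof. by rewrite /inner -scalemxAr mxE. Qed.

Lemma innerZl d (a : R) (x y : 'cV[R]_d) : inner (a *: x) y = a * inner x y.
Proof. by rewrite innerC innerZr innerC. Qed.

Lemma innerBr d (x y z : 'cV[R]_d) : inner x (y - z) = inner x y - inner x z.
Proof. by rewrite -scaleN1r innerDr innerZr mulN1r. Qed.

Lemma innerBl d (x y z : 'cV[R]_d) : inner (x - y) z = inner x z - inner y z.
Proof. by rewrite innerC innerBr !(innerC z). Qed.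

Lemma inner_mulmx d e (M : 'M[R]_(d, e)) x y :
  inner (M *m x) y = inner x (M^T *m y).
Proof. by rewrite /inner trmx_mul mulmxA. Qed.

Lemma inner_mulmxr d e (M : 'M[R]_(d, e)) x y :
  inner x (M *m y) = inner (M^T *m x) y.
Proof. by rewrite inner_mulmx trmxK. Qed.

Lemma inner_ge0 d (x : 'cV[R]_d) : 0 <= inner x x.
Proof. by rewrite innerE sumr_ge0 // => k _; rewrite -expr2 sqr_ge0. Qed.

Lemma inner_eq0 d (x : 'cV[R]_d) : (inner x x == 0) = (x == 0).
Proof.
apply/eqP/eqP => [|->]; last by rewrite /inner mulmx0 mxE.
rewrite innerE => /eqP; rewrite psumr_eq0 => [/allP x0|k _]; last first.
  by rewrite -expr2 sqr_ge0.
apply/colP => k; rewrite mxE; apply/eqP; move: (x0 k (mem_index_enum _)).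
by rewrite mulf_eq0 orbb.
Qed.

Lemma inner_gt0 d (x : 'cV[R]_d) : (0 < inner x x) = (x != 0).
Proof. by rewrite lt_def inner_ge0 andbT inner_eq0. Qed.

Lemma sqr_enorm d (x : 'cV[R]_d) : enorm x ^+ 2 = inner x x.
Proof. by rewrite sqr_sqrtr // inner_ge0. Qed.

Lemma mul_col_tr d (v x : 'cV[R]_d) : v *m v^T *m x = inner v x *: v.
Proof.
by rewrite -mulmxA [v^T *m x]mx11_scalar mul_mx_scalar.
Qed.

Lemma inner_rank1 d (v x y : 'cV[R]_d) :
  inner x (v *m v^T *m y) = inner v x * inner v y.
Proof. by rewrite mul_col_tr innerZr (innerC x) mulrC. Qed.

Lemma cauchy_schwarz_mx d (M : 'M[R]_d) (x y : 'cV[R]_d) : sym_posdef M ->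
  inner x (M *m y) ^+ 2 <= inner x (M *m x) * inner y (M *m y).
Proof.
move=> [Msym Mpos]; have [->|y0] := eqVneq y 0.
  by rewrite !mulmx0 -(scale0r (0 : 'cV[R]_d)) !innerZr !mul0r mulr0 expr0n.
have c0 := Mpos _ y0.
set a := inner x (M *m x); set b := inner x (M *m y); set c := inner y (M *m y).
have bC : inner y (M *m x) = b by rewrite innerC inner_mulmx Msym.
(* At [c *: x - b *: y] the form of [M] takes the value [c * (a * c - b ^+ 2)], and [c > 0]. *)
have : 0 <= inner (c *: x - b *: y) (M *m (c *: x - b *: y)).
  have [->|] := eqVneq (c *: x - b *: y) 0; last by move/Mpos/ltW.
  by rewrite mulmx0 inner_ge0.
rewrite mulmxBr -!scalemxAr !(innerBl, innerBr, innerZl, innerZr) bC.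
rewrite -/a -/b -/c.
rewrite [X in 0 <= X](_ : _ = c * (a * c - b ^+ 2)); last by ring.
by rewrite pmulr_rge0 // subr_ge0.
Qed.

Lemma sym_posdef1 d : sym_posdef (1%:M : 'M[R]_d).
Proof. by split=> [|x x0]; rewrite ?trmx1 // mul1mx inner_gt0. Qed.

Lemma cauchy_schwarz d (x y : 'cV[R]_d) :
  inner x y ^+ 2 <= inner x x * inner y y.
Proof. by have := cauchy_schwarz_mx x y (@sym_posdef1 d); rewrite !mul1mx. Qed.

End Inner.

(** * Spectral theorem, square root, eigenvalue monotonicity and overlap of eigenvectors *)

Section Spectral.
Context {R : realType}.
Implicit Types d : nat.

Lemma char_poly_conj d (H A : 'M[R]_d) :
  H *m H = 1%:M -> char_poly (H *m A *m H) = char_poly A.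
Proof.
move=> HH; rewrite /char_poly.
have HHP : map_mx polyC H *m map_mx polyC H = 1%:M.
  by rewrite -map_mxM HH map_mx1.
have -> : char_poly_mx (H *m A *m H)
    = map_mx polyC H *m char_poly_mx A *m map_mx polyC H.
  rewrite /char_poly_mx mulmxBr mulmxBl !map_mxM.
  by rewrite scalar_mxC -(mulmxA 'X%:M) HHP mulmx1.
by rewrite !det_mulmx mulrC mulrA -det_mulmx HHP det1 mul1r.
Qed.

(** [eigenvalueP] provides a row vector, that is a left eigenvector; by symmetry its transpose is a
    right one. *)
Lemma sym_root_unit_eigenvector d (A : 'M[R]_d) (a : R) :
  A^T = A -> root (char_poly A) a ->
  exists u : 'cV[R]_d, inner u u = 1 /\ A *m u = a *: u.
Proof.
rewrite -eigenvalue_root_char => Asym /eigenvalueP[r rA r0].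
have rT0 : r^T != 0 by rewrite trmx_eq0.
exists ((enorm r^T)^-1 *: r^T); split.
  rewrite innerZl innerZr -sqr_enorm; field.
  by rewrite sqrtr_eq0 -ltNge inner_gt0.
by rewrite -scalemxAr -[A]Asym -trmx_mul rA linearZ /= !scalerA mulrC.
Qed.

(* Householder reflection in the hyperplane orthogonal to [u - e]. *)
Lemma reflection d (u e : 'cV[R]_d) : inner u u = 1 -> inner e e = 1 ->
  exists H : 'M[R]_d, [/\ H^T = H, H *m H = 1%:M & H *m e = u].
Proof.
move=> u1 e1; have [->|ue] := eqVneq u e.
  by exists 1%:M; rewrite trmx1 !mul1mx.
set w := u - e; set s := inner w w.
have s0 : s != 0 by rewrite inner_eq0 subr_eq0.
have sE : s = 2 - 2 * inner u e.
  by rewrite /s /w !(innerBl, innerBr) u1 e1 (innerC e u); ring.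
(* This makes the reflection [x - (2 / s) <w, x> w] send [e] to [e + w = u]. *)
have weE : inner w e = - (s / 2) by rewrite /w innerBl e1 sE; field.
have ww : w *m w^T *m (w *m w^T) = s *: (w *m w^T).
  by rewrite mulmxA mul_col_tr scalemxAl.
have wE : w = u - e by [].
clearbody s w; exists (1%:M - (2 / s) *: (w *m w^T)); split.
- by rewrite linearB linearZ /= trmx1 trmx_mul trmxK.
- rewrite mulmxBr mulmx1 mulmxBl mul1mx -scalemxAr -scalemxAl ww !scalerA.
  rewrite -addrA -opprD -scalerBl.
  by have -> : 2 / s - 2 / s * (2 / s) * s = - (2 / s) :> R;
    [field | rewrite scaleNr subrr subr0].
- rewrite mulmxBl mul1mx -scalemxAl mul_col_tr scalerA weE.
  have -> : 2 / s * - (s / 2) = -1 :> R by field.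
  by rewrite scaleN1r opprK wE addrC subrK.
Qed.

(** Deflation: conjugating by a reflection that takes the first basis vector to a unit eigenvector
    for [lam ord0] splits off a 1 x 1 block, and induction applies to the remaining block. The order
    of the diagonal is that of [lam]. *)
Lemma sym_orthodiag d (A : 'M[R]_d) (lam : 'I_d -> R) :
  A^T = A -> char_poly A = \prod_(i < d) ('X - (lam i)%:P) ->
  exists P : 'M[R]_d, P^T *m P = 1%:M /\
    A = P *m diag_mx (\row_i lam i) *m P^T.
Proof.
elim: d A lam => [|d IHd] A lam Asym Achar.
  by exists 1%:M; rewrite !flatmx0; split=> //; apply: flatmx0.
have [|u [u1 Au]] := @sym_root_unit_eigenvector _ A (lam ord0) Asym.
  by rewrite Achar big_ord_recl rootM root_XsubC eqxx.
pose e : 'cV[R]_(1 + d) := col_mx 1%:M 0.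
have e1 : inner e e = 1.
  by rewrite /inner tr_col_mx mul_row_col trmx1 mul1mx mulmx0 addr0 mxE.
have [H [Hsym HH He]] := reflection u1 e1.
pose T : 'M[R]_(1 + d) := H *m A *m H.
have Tsym : T^T = T by rewrite /T !trmx_mul Hsym Asym mulmxA.
have Te : T *m e = lam ord0 *: e.
  by rewrite /T -!mulmxA He Au -scalemxAr -He mulmxA HH mul1mx.
have Tchar : char_poly T = char_poly A by apply: char_poly_conj.
pose A' := drsubmx T.
(* [Te] gives the first column of [T], and symmetry the first row. *)
have TE : T = block_mx (lam ord0)%:M 0 0 A'.
  move: Te; rewrite -{1}[T]submxK /e mul_block_col !mulmx1 !mulmx0 !addr0.
  rewrite scale_col_mx scaler0 scalemx1 => /eq_col_mx[ul dl].
  rewrite -[T]submxK ul dl; congr block_mx.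
  by rewrite -[RHS]trmx0 -dl trmx_dlsub Tsym.
have A'sym : A'^T = A' by rewrite trmx_drsub Tsym.
have A'char : char_poly A' = \prod_(i < d) ('X - (lam (lift ord0 i))%:P).
  have lam0 : 'X - (lam ord0)%:P != 0 by rewrite polyXsubC_eq0.
  (* The block form factors the characteristic polynomial of [T]; the common factor for [lam ord0]
     cancels. *)
  apply: (mulfI lam0); move: Tchar; rewrite Achar big_ord_recl => <-.
  rewrite TE /char_poly /char_poly_mx map_block_mx !map_mx0.
  rewrite scalar_mx_block opp_block_mx add_block_mx !oppr0 !addr0.
  by rewrite det_ublock det_mx11 !mxE eqxx.
have [P' [P'P' A'E]] := IHd A' _ A'sym A'char.
pose Q : 'M[R]_(1 + d) := block_mx 1%:M 0 0 P'.
have QQ : Q^T *m Q = 1%:M.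
  rewrite /Q tr_block_mx !trmx0 trmx1 mulmx_block P'P'.
  by rewrite !(mulmx0, mul0mx, mulmx1, addr0, add0r) -scalar_mx_block.
pose D : 'M[R]_(1 + d) := diag_mx (\row_i lam i).
have DE : D = block_mx (lam ord0)%:M 0 0 (diag_mx (\row_i lam (lift ord0 i))).
  have rowE : \row_i lam i =
      row_mx (lam ord0)%:M (\row_i lam (lift ord0 i)) :> 'rV_(1 + d).
    apply/rowP => k; rewrite !mxE; case: splitP => j kj; rewrite !mxE.
      by rewrite ord1 eqxx; congr lam; apply: val_inj; rewrite /= kj ord1.
    by congr lam; apply: val_inj; rewrite /= kj.
  rewrite /D rowE (@diag_mx_row _ d 1); congr block_mx.
  by apply/matrixP => k l; rewrite !mxE !ord1.
exists (H *m Q); split.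
  by rewrite trmx_mul Hsym -mulmxA (mulmxA H) HH mul1mx.
have -> : A = H *m T *m H.
  by rewrite /T -!mulmxA HH mulmx1 mulmxA HH mul1mx.
have -> : T = Q *m D *m Q^T.
  rewrite TE DE /Q tr_block_mx !trmx0 trmx1 !mulmx_block A'E.
  by rewrite !(mulmx0, mul0mx, mulmx1, mul1mx, addr0, add0r).
by rewrite trmx_mul Hsym !mulmxA.
Qed.

Lemma inner_orthodiag d (P : 'M[R]_d) (lam : 'I_d -> R) (x : 'cV[R]_d) :
  inner x (P *m diag_mx (\row_i lam i) *m P^T *m x) =
    \sum_k lam k * (P^T *m x) k 0 ^+ 2.
Proof.
rewrite -!mulmxA inner_mulmxr innerE; apply: eq_bigr => k _.
by rewrite mul_diag_mx !mxE expr2 mulrCA.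
Qed.

Lemma inner_orthogonal d (P : 'M[R]_d) (x : 'cV[R]_d) :
  P^T *m P = 1%:M -> \sum_k (P^T *m x) k 0 ^+ 2 = inner x x.
Proof.
move=> /mulmx1C PP; rewrite -{3}(mul1mx x) -PP -mulmxA inner_mulmxr.
by rewrite innerE; apply: eq_bigr => k _; rewrite expr2.
Qed.

Lemma eigenvalue_gt0 d (B : 'M[R]_d) (lam : 'I_d -> R) i :
  sym_posdef B -> ordered_eigenvalues B lam -> 0 < lam i.
Proof.
move=> [Bsym Bpos] [_ Bchar].
have [|u [u1 Bu]] := @sym_root_unit_eigenvector _ B (lam i) Bsym.
  by rewrite Bchar (bigD1 i) //= rootM root_XsubC eqxx.
have : 0 < inner u (B *m u) by rewrite Bpos // -inner_gt0 u1.
by rewrite Bu innerZr u1 mulr1.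
Qed.

(** The choice in [sqrtmx] yields an element of its defining set once that set is inhabited; the
    witness takes square roots of the eigenvalues in an orthonormal eigenbasis. *)
Lemma sqrtmxP d (B : 'M[R]_d) (lam : 'I_d -> R) :
  sym_posdef B -> ordered_eigenvalues B lam ->
  sym_posdef (sqrtmx B) /\ sqrtmx B *m sqrtmx B = B.
Proof.
move=> Bpos Blam.
apply: (@xgetPex _ 0 [set S | sym_posdef S /\ S *m S = B]%classic).
have [P [PP BE]] := sym_orthodiag Bpos.1 Blam.2.
have lam0 i := eigenvalue_gt0 i Bpos Blam.
pose s i := Num.sqrt (lam i).
exists (P *m diag_mx (\row_i s i) *m P^T); split; [split=> [|x x0]|].
- by rewrite !trmx_mul trmxK tr_diag_mx mulmxA.
- rewrite inner_orthodiag lt_def; apply/andP; split; last first.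
    by apply: sumr_ge0 => k _; rewrite mulr_ge0 ?sqr_ge0 ?sqrtr_ge0.
  apply: contra_neq x0 => /eqP.
  rewrite psumr_eq0 => [/allP y0|k _]; last first.
    by rewrite mulr_ge0 ?sqr_ge0 ?sqrtr_ge0.
  apply/eqP; rewrite -inner_eq0 -(inner_orthogonal x PP) big1 // => k _.
  apply/eqP; have := y0 k (mem_index_enum _); rewrite mulf_eq0.
  by rewrite gt_eqF //= sqrtr_gt0.
- rewrite !mulmxA -(mulmxA _ P^T P) PP mulmx1 -(mulmxA P) mulmx_diag.
  rewrite [RHS]BE; congr (P *m diag_mx _ *m _).
  by apply/rowP => k; rewrite !mxE -expr2 sqr_sqrtr // ltW.
Qed.

(* Dimension count of the min-max principle: some [x != 0] is orthogonal to the
   eigenvectors of [A] after the [i]-th and to those of [B] before the [i]-th,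
   as these are only [d - 1] vectors. *)
Lemma ordered_eigenvalues_mono d (A B : 'M[R]_d) (alpha beta : 'I_d -> R)
    (c : R) i :
  A^T = A -> B^T = B -> 0 <= c ->
  ordered_eigenvalues A alpha -> ordered_eigenvalues B beta ->
  (forall x, inner x (A *m x) <= c * inner x (B *m x)) ->
  alpha i <= c * beta i.
Proof.
move=> Asym Bsym c0 [alphaS Achar] [betaS Bchar] AB.
have [P [PP AE]] := sym_orthodiag Asym Achar.
have [Q [QQ BE]] := sym_orthodiag Bsym Bchar.
(* The columns of [N] are the vectors that [x] must be orthogonal to. Column [i] is left zero, so
   [N] is singular and its left kernel contains a nonzero vector. *)
pose N : 'M[R]_d := \matrix_(r, k)
  if (i < k)%N then P r k else if (k < i)%N then Q r k else 0.
have /det0P[v v0 vN] : \det N == 0.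
  rewrite -det_tr (expand_det_row _ i) big1 // => k _.
  by rewrite !mxE ltnn mul0r.
pose x := v^T.
have xP (k : 'I_d) : (i < k)%N -> (P^T *m x) k 0 = 0.
  move=> ik; transitivity ((v *m N) 0 k); last by rewrite vN mxE.
  rewrite !mxE; apply: eq_bigr => r _.
  by rewrite !mxE ik mulrC.
have xQ (k : 'I_d) : (k < i)%N -> (Q^T *m x) k 0 = 0.
  move=> ki; transitivity ((v *m N) 0 k); last by rewrite vN mxE.
  rewrite !mxE; apply: eq_bigr => r _.
  by rewrite !mxE ki ltnNge ltnW //= mulrC.
have xx0 : 0 < inner x x by rewrite inner_gt0 trmx_eq0.
(* With [xx = inner x x], the chain is [alpha i * xx <= <x, A x> <= c * <x, B x> <= c * beta i *
   xx]. In the outer steps only coordinates [k <= i], respectively [k >= i], contribute. *)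
rewrite -(ler_pM2r xx0); apply: (@le_trans _ _ (inner x (A *m x))).
  rewrite AE inner_orthodiag -(inner_orthogonal x PP) mulr_sumr.
  apply: ler_sum => k _; have [ki|ik] := leqP k i.
    by rewrite ler_wpM2r ?sqr_ge0 ?alphaS.
  by rewrite xP // expr0n !mulr0.
apply: le_trans (AB x) _; rewrite -mulrA ler_wpM2l //.
rewrite BE inner_orthodiag -(inner_orthogonal x QQ) mulr_sumr.
apply: ler_sum => k _; have [ik|ki] := leqP i k.
  by rewrite ler_wpM2r ?sqr_ge0 ?betaS.
by rewrite xQ // expr0n !mulr0.
Qed.

(** With [s = sqrt l], the factorization [S^2 - l = (S + s)(S - s)] shows that [S + s] kills
    [g = S f - s f]; being positive definite, it forces [g = 0]. *)
Lemma sqrt_eigenvector d (S : 'M[R]_d) (l : R) (f : 'cV[R]_d) :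
  sym_posdef S -> 0 <= l -> S *m S *m f = l *: f -> S *m f = Num.sqrt l *: f.
Proof.
move=> [Ssym Spos] l0 Sf; apply/eqP; rewrite -subr_eq0.
set g := _ - _; apply: contraT => g0.
have /(congr1 (inner g)) : S *m g + Num.sqrt l *: g = 0.
  rewrite /g mulmxBr mulmxA Sf -scalemxAr scalerBr scalerA -expr2 sqr_sqrtr //.
  by rewrite addrA subrK subrr.
rewrite innerDr innerZr -(scale0r g) innerZr mul0r => /eqP.
rewrite gt_eqF // ltr_pwDl ?Spos //.
by rewrite mulr_ge0 ?sqrtr_ge0 ?inner_ge0.
Qed.

(** The core estimate, in squared form and for any symmetric [M] with [1 <= M <= c] as quadratic
    forms. *)
Lemma eigenvector_overlap d (S M : 'M[R]_d) (c : R) (lam mu : 'I_d -> R)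
    (i j : 'I_d) (eA eB : 'cV[R]_d) :
  sym_posdef S -> M^T = M ->
  (forall x, inner x x <= inner x (M *m x)) ->
  (forall x, inner x (M *m x) <= c * inner x x) ->
  ordered_eigenvalues (S *m S) lam -> ordered_eigenvalues (S *m M *m S) mu ->
  0 < lam i -> 0 < lam j ->
  unit_eigenvector (S *m M *m S) (mu i) eA ->
  unit_eigenvector (S *m S) (lam j) eB ->
  inner eA eB ^+ 2 <= c * (Num.min (lam i) (lam j) / Num.max (lam i) (lam j)).
Proof.
move=> Spos Msym M_ge M_le lamP muP li0 lj0 [AeA /(congr1 (@GRing.exp R ^~ 2))].
rewrite sqr_enorm expr1n => eA1 [BeB /(congr1 (@GRing.exp R ^~ 2))].
rewrite sqr_enorm expr1n => eB1.
have Ssym := Spos.1.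
have Mpos : sym_posdef M.
  by split=> // x x0; apply: lt_le_trans (M_ge x); rewrite inner_gt0.
have c1 : 1 <= c by have := le_trans (M_ge eA) (M_le eA); rewrite eA1 mulr1.
have c0 : 0 <= c by apply: le_trans c1.
have SeB : S *m eB = Num.sqrt (lam j) *: eB.
  by apply: sqrt_eigenvector => //; exact: ltW.
have innerS x y : inner x (S *m y) = inner (S *m x) y.
  by rewrite inner_mulmx Ssym.
have SS_le_SMS x : inner x (S *m S *m x) <= 1 * inner x (S *m M *m S *m x).
  by rewrite mul1r -!mulmxA !(innerS x).
have SMS_le_SS x : inner x (S *m M *m S *m x) <= c * inner x (S *m S *m x).
  by rewrite -!mulmxA !(innerS x).
have SSsym : (S *m S)^T = S *m S by rewrite trmx_mul Ssym.
have SMSsym : (S *m M *m S)^T = S *m M *m S.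
  by rewrite !trmx_mul Ssym Msym mulmxA.
have lam_le_mu : lam i <= mu i.
  rewrite -[mu i]mul1r.
  exact: (ordered_eigenvalues_mono i SSsym SMSsym ler01 lamP muP).
have mu_le_lam : mu i <= c * lam i.
  exact: (ordered_eigenvalues_mono i SMSsym SSsym c0 muP lamP).
have mu0 : 0 < mu i by apply: lt_le_trans lam_le_mu.
have muE : inner (S *m eA) (M *m (S *m eA)) = mu i.
  by rewrite -innerS !mulmxA AeA innerZr eA1 mulr1.
set t := inner eA eB.
have bound1 : lam j * t ^+ 2 <= mu i.
  have -> : lam j * t ^+ 2 = inner (S *m eA) eB ^+ 2.
    by rewrite -innerS SeB innerZr exprMn sqr_sqrtr // ltW.
  apply: le_trans (cauchy_schwarz _ _) _; rewrite eB1 mulr1 -muE.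
  exact: M_ge.
have bound2 : mu i * t ^+ 2 <= c * lam j.
  have mutE : mu i * t = Num.sqrt (lam j) * inner (S *m eA) (M *m eB).
    rewrite /t -innerZl -AeA -!mulmxA !inner_mulmx Ssym SeB Msym.
    by rewrite -!scalemxAr innerZr.
  (* The extra factor [mu i] completes the square [(mu i * t) ^+ 2], to which Cauchy-Schwarz for [M]
     applies. *)
  rewrite -(ler_pM2l mu0).
  have -> : mu i * (mu i * t ^+ 2) = (mu i * t) ^+ 2 by ring.
  rewrite mutE exprMn sqr_sqrtr ?(ltW lj0) //.
  rewrite (mulrC c) (mulrCA (mu i)) ler_pM2l //.
  apply: le_trans (cauchy_schwarz_mx _ _ Mpos) _; rewrite muE ler_pM2l //.
  by have := M_le eB; rewrite eB1 mulr1.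
(* If [lam i <= lam j], [bound1] and [mu i <= c * lam i] conclude; otherwise [bound2] and
   [lam i <= mu i] do. *)
case: (leP (lam i) (lam j)) => _; rewrite mulrA ler_pdivlMr //.
  by rewrite mulrC (le_trans bound1).
by rewrite mulrC (le_trans _ bound2) // ler_wpM2r ?sqr_ge0.
Qed.

End Spectral.

(** * The quadratic form of the sum of rank-one matrices *)

Section Perturbation.
Context {R : realType}.
Context (d m : nat) (v : 'I_m -> 'cV[R]_d).

Let W := \sum_(k < m) v k *m (v k)^T.

Lemma inner_sum_rank1 (x : 'cV[R]_d) :
  inner x (W *m x) = \sum_(k < m) inner (v k) x ^+ 2.
Proof.
rewrite /W mulmx_suml /inner mulmx_sumr summxE; apply: eq_bigr => k _.
exact: inner_rank1.
Qed.

Lemma tr_sum_rank1 : W^T = W.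
Proof.
by rewrite /W linear_sum; apply: eq_bigr => k _; rewrite /= trmx_mul trmxK.
Qed.

(** Cauchy-Schwarz bounds each of the [m] squares by [max_enorm v ^+ 2 * inner x x]. *)
Lemma inner_sum_rank1_le (x : 'cV[R]_d) :
  inner x (W *m x) <= m%:R * max_enorm v ^+ 2 * inner x x.
Proof.
rewrite inner_sum_rank1 -mulrA.
have -> (a : R) : m%:R * a = \sum_(k < m) a.
  by rewrite sumr_const card_ord mulr_natl.
apply: ler_sum => k _; apply: le_trans (cauchy_schwarz _ _) _.
rewrite ler_wpM2r ?inner_ge0 // -sqr_enorm ler_sqr ?nnegrE ?sqrtr_ge0 //.
  exact: le_bigmax.
by apply: le_trans (le_bigmax _ _ k); apply: sqrtr_ge0.
Qed.

End Perturbation.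

Theorem theorem1 (R : realType) (m : nat) (hm : (1 <= m)%N) :
  exists p : {poly {poly R}},
    forall (d : nat) (hd : (2 <= d)%N)
           (B : 'M[R]_d) (lam : 'I_d -> R) (v : 'I_m -> 'cV[R]_d),
      sym_posdef B ->
      ordered_eigenvalues B lam ->
      let A := perturbed B v in
      let C := p.[d%:R, max_enorm v] in
      0 < C /\
      forall (mu : 'I_d -> R), ordered_eigenvalues A mu ->
      forall (i j : 'I_d) (eA eB : 'cV[R]_d),
        unit_eigenvector A (mu i) eA ->
        unit_eigenvector B (lam j) eB ->
        `| inner eA eB | <=
          C * Num.sqrt (Num.min (lam i) (lam j) / Num.max (lam i) (lam j)).
Proof.
(* The outer variable of the bivariate polynomial receives [d], the inner one the maximal norm;
   [%:P] makes the witness constant in the outer one. *)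
exists (1 + m%:R *: 'X^2)%:P => d _ B lam v Bpos Blam A C.
set K := m%:R * max_enorm v ^+ 2.
have CE : C = 1 + K by rewrite /C hornerC hornerD hornerZ hornerXn hornerC.
have K0 : 0 <= K by rewrite mulr_ge0 ?ler0n ?sqr_ge0.
have C1 : 1 <= C by rewrite CE lerDl.
have C0 : 0 < C by apply: lt_le_trans C1.
split=> // mu Amu i j eA eB eAP eBP.
have [Spos SS] := sqrtmxP Bpos Blam.
pose W := \sum_(k < m) v k *m (v k)^T.
have AE : A = sqrtmx B *m (1%:M + W) *m sqrtmx B.
  by rewrite mulmxDr mulmx1 mulmxDl SS.
have Msym : (1%:M + W)^T = 1%:M + W by rewrite linearD /= trmx1 tr_sum_rank1.
have lam0 k := eigenvalue_gt0 k Bpos Blam.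
set r := _ / _.
have r0 : 0 <= r by rewrite divr_ge0 // ltW // ?lt_min ?lt_max !lam0.
have : inner eA eB ^+ 2 <= C * r.
  apply: (eigenvector_overlap Spos Msym) => //.
  - move=> x; rewrite mulmxDl mul1mx innerDr lerDl inner_sum_rank1.
    by apply: sumr_ge0 => k _; apply: sqr_ge0.
  - move=> x; rewrite mulmxDl mul1mx innerDr CE mulrDl mul1r lerD2l.
    exact: inner_sum_rank1_le.
  - by rewrite SS.
  - by rewrite -AE; exact: Amu.
  - by rewrite -AE.
  - by rewrite SS.
(* Under the square root the goal becomes [inner eA eB ^+ 2 <= C ^+ 2 * r], which follows from [t2]
   since [1 <= C] and [0 <= r]. *)
move=> t2; rewrite -[X in X * _](ger0_norm (ltW C0)) -!sqrtr_sqr.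
rewrite -sqrtrM ?sqr_ge0 // ler_wsqrtr // (le_trans t2) //.
by rewrite ler_wpM2r // expr2 ler_peMr // ltW.
Qed.
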